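(* Let $b\ge2$ and $n\ge1$. Then $K(n+1)>bK(n)$, except when $b\ge5$ is odd and $n=2$; in that exceptional case one has $K(3)>(b-1)K(2)$.
   Context: Fix a base $b\ge2$. For $v\in\mathbb{N}$, $s(v)$ is the sum of the base-$b$ digits of $v$, $f(v)=v+s(v)$, and $F(u)=|\{v\in\mathbb{N}: f(v)=u\}|$. For $n\ge1$, $K(n)$ is the smallest $u\in\mathbb{N}$ with $F(u)=n$. *)

(* Defs.v *)
From mathcomp Require Import all_boot.
From mathcomp Require Import boolp.

Set Implicit Arguments.
Unset Strict Implicit.
Unset Printing Implicit Defensive.

(* [v %/ b ^ i %% b] is the base-b digit of v at position i.  For b >= 2 we
   have v < b ^ v, so all digits at positions i >= v are zero. *)
Definition s (b v : nat) : nat := \sum_(i < v) (v %/ b ^ i) %% b.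

Definition f (b v : nat) : nat := v + s b v.

Lemma leq_f (b v : nat) : v <= f b v.
Proof. exact: leq_addr. Qed.

(* By [leq_f], every solution v of f(v) = u satisfies v <= u, so the solutions
   in 'I_u.+1 are all the solutions in nat. *)
Definition F (b u : nat) : nat := #|[set v : 'I_u.+1 | f b v == u]|.

(* The value 0 in the [right] branch is a junk value.  As 0 has F(0) = 1, it is
   never the genuine value of K b n for n > 1: a strict lower bound on K b n
   with n > 1 thus entails that some u with F(u) = n exists. *)
Definition K (b n : nat) : nat :=
  match pselect (exists u, F b u == n) with
  | left ex_u => ex_minn ex_u
  | right _ => 0
  end.

(* Main.v *)
(** Let [Fm m u] count the solutions of [f v = u] with [v < b^m].  Since
    [f (c b^m + w) = c (b^m + 1) + f w] and [w |-> b^m - 1 - w] reflects the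
    values of [f] on [[0, b^m)], a number [u = c (b^m + 1) + x < b^(m+1)] with
    [1 <= c < b] and [x + z + 2 = m (b - 1)] satisfies [F u = F x + F z].  For
    any [u] with [F u >= 2] there is a number [c (b^m + 1) + x <= u] of this
    shape, congruent to [u] modulo [b - 1], with [F x + F z = F u] and
    [F x, F z >= 1].  Given such a decomposition of [K (n+1)], if [F x = 1] then
    [F z = n], and [z] is logarithmic in [K (n+1)].  Otherwise decrease [F x] or
    [F z] by one within a residue class modulo [b - 1]; if this lowers the
    argument by [k (b - 1)] with [k >= 2], it lowers [m] by [k], hence the
    leading power by a factor of at least [b^2].  Only for [b] odd and
    [F x = F z = 2] may [k] be [1]; there [K 3] is bounded by the explicit
    values [b^2 + 1] and, for [b = 3], [28]. *)

Require Import Defs.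
From mathcomp Require Import all_boot.
From mathcomp Require Import zify.

Section Generators.

Set Implicit Arguments.
Unset Strict Implicit.
Unset Printing Implicit Defensive.

Variable b : nat.
Hypothesis b_gt1 : 1 < b.

Let b_gt0 : 0 < b. Proof. by lia. Qed.

(** * Digit sums and the values of [f] below a power of [b] *)

Lemma s_digits N v : v < b ^ N -> s b v = \sum_(i < N) (v %/ b ^ i) %% b.
Proof.
have ext M1 M2 : M1 <= M2 -> v < b ^ M1 ->
    \sum_(i < M1) (v %/ b ^ i) %% b = \sum_(i < M2) (v %/ b ^ i) %% b.
  move=> le12 lt1; rewrite -!(big_mkord xpredT (fun i => (v %/ b ^ i) %% b)).
  rewrite (big_cat_nat (n := M1) (p := M2)) //= [X in _ = _ + X]big_nat_cond.
  rewrite [X in _ = _ + X]big1 ?addn0 // => i /andP[/andP[lei _] _].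
  by rewrite divn_small ?mod0n // (leq_trans lt1) // leq_pexp2l.
move=> ltv; rewrite /s; case: (leqP N v) => [le|/ltnW le]; first by rewrite -(ext N v).
by rewrite (ext v N) // ltn_expl.
Qed.

Lemma f_lead c m w : c < b -> w < b ^ m -> f b (c * b ^ m + w) = c * (b ^ m).+1 + f b w.
Proof.
move=> ltc ltw; rewrite /f (s_digits ltw) (@s_digits m.+1); last first.
  by rewrite expnS; nia.
rewrite big_ord_recr /= divnMDl ?expn_gt0 ?b_gt0 // (divn_small ltw) addn0 modn_small //.
rewrite (eq_bigr (fun i : 'I_m => (w %/ b ^ i) %% b)); first by lia.
move=> [i lti] _ /=; rewrite -(subnK (ltnW lti)) expnD mulnA divnMDl ?expn_gt0 ?b_gt0 //.
have -> : b ^ (m - i) = b ^ (m - i).-1 * b by rewrite -expnSr prednK // subn_gt0.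
by rewrite mulnA modnMDl.
Qed.

Lemma digit_lead m w : w < b ^ m.+1 ->
  exists c w', [/\ c < b, w' < b ^ m & w = c * b ^ m + w'].
Proof.
move=> ltw; exists (w %/ b ^ m), (w %% b ^ m); split; last exact: divn_eq.
  by rewrite ltn_divLR ?expn_gt0 ?b_gt0 // -expnS.
by rewrite ltn_mod expn_gt0 b_gt0.
Qed.

Lemma f0 : f b 0 = 0. Proof. by rewrite /f /s big_ord0. Qed.

(** Complementing each of the [m] digits [d] to [b - 1 - d] makes the two numbers add up to
    [b ^ m - 1] and their digit sums to [m * b.-1]. *)
Lemma f_compl m w : w < b ^ m -> f b w + f b (b ^ m - w.+1) = b ^ m + m * b.-1 - 1.
Proof.
elim: m w => [|m IHm] w; first by rewrite expn0 ltnS leqn0 => /eqP ->; rewrite f0.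
move=> /digit_lead[c [w' [ltc ltw ->]]].
have [e Eb] : exists e, b = e + c + 1 by exists (b.-1 - c); lia.
have EB : b * b ^ m = e * b ^ m + c * b ^ m + b ^ m by rewrite {1}Eb !mulnDl mul1n.
have -> : b ^ m.+1 - (c * b ^ m + w').+1 = e * b ^ m + (b ^ m - w'.+1).
  by rewrite expnS EB; lia.
have := IHm _ ltw; rewrite !f_lead //; try lia.
by rewrite expnS EB !mulnS mulSn; have := expn_gt0 b m; lia.
Qed.

Lemma f_bound m w : w < b ^ m -> f b w <= b ^ m + m * b.-1 - 1.
Proof. by move=> /f_compl <-; apply: leq_addr. Qed.

(** Powers of an odd [b] are odd, so [v] and its digit sum have the same parity. *)
Lemma f_even v : odd b -> ~~ odd (f b v).
Proof.
move=> ob; have := ltn_expl v b_gt1; move: {2}v => m.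
elim: m v => [|m IHm] v; first by rewrite expn0 ltnS leqn0 => /eqP ->; rewrite f0.
move=> /digit_lead[c [w [ltc ltw ->]]]; rewrite f_lead // oddD (negbTE (IHm _ ltw)).
by rewrite addbF oddM oddS oddX ob orbT andbF.
Qed.

(** * Counting solutions by leading digit *)

Definition Fm m u := \sum_(0 <= w < b ^ m) (f b w == u).

Lemma F_sum u : F b u = \sum_(0 <= v < u.+1) (f b v == u).
Proof.
rewrite /F cardsE -sum1_card big_mkcond big_mkord; apply: eq_bigr => i _.
by rewrite (_ : (i \in _) = (f b i == u)) //; case: (f b i == u).
Qed.

Lemma F_Fm m u : u < b ^ m -> F b u = Fm m u.
Proof.
move=> ltu; rewrite F_sum /Fm (big_cat_nat (n := u.+1) (p := b ^ m)) //=.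
rewrite [X in _ = _ + X]big_nat_cond [X in _ = _ + X]big1 ?addn0 //.
move=> i /andP[/andP[lei _] _]; apply/eqP; rewrite eqb0; apply: contraTneq lei => <-.
by rewrite -leqNgt leq_f.
Qed.

(** With [f_bound], this keeps the values of [f] below [b ^ m] under [2 * b ^ m], so at most two
    adjacent leading digits contribute to one [u]. *)
Lemma mul_pred_lt_expn m : m * b.-1 < b ^ m.
Proof.
elim: m => // m IHm; have : b.-1 <= b.-1 * b ^ m by rewrite leq_pmulr // expn_gt0 b_gt0.
have EB : b * b ^ m = b.-1 * b ^ m + b ^ m by rewrite -{1}(prednK b_gt0) mulSn addnC.
by rewrite expnS mulSn EB; lia.
Qed.

Lemma Fm_out m u : b ^ m + m * b.-1 - 1 < u -> Fm m u = 0.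
Proof.
move=> ltu; rewrite /Fm big_nat_cond big1 // => i /andP[/andP[_ /f_bound lei] _].
by apply/eqP; rewrite eqb0; apply: contraTneq lei => ->; rewrite -ltnNge.
Qed.

Lemma Fm_compl m u v : u + v = b ^ m + m * b.-1 - 1 -> Fm m u = Fm m v.
Proof.
move=> E; rewrite /Fm big_nat_rev /= big_nat_cond [RHS]big_nat_cond.
apply: eq_bigr => w /andP[/andP[_ ltw] _]; rewrite add0n; have := f_compl ltw.
by move=> E'; congr nat_of_bool; apply/eqP/eqP; lia.
Qed.

Lemma sum_block (h : nat -> nat) c B :
  \sum_(0 <= v < c * B) h v = \sum_(i < c) \sum_(0 <= w < B) h (i * B + w).
Proof.
elim: c => [|c IHc]; first by rewrite mul0n big_geq ?big_ord0.
rewrite big_ord_recr /= -IHc (big_cat_nat (n := c * B)) //=; last by rewrite leq_mul2r leqnSn orbT.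
congr (_ + _); rewrite -{1}[c * B]add0n big_addn mulSn addnK.
by apply: eq_bigr => i _; rewrite addnC.
Qed.

(* The part of [Fm m.+1 u] contributed by the solutions with leading digit [c]. *)
Definition Fm_lead m u c := if c * (b ^ m).+1 <= u then Fm m (u - c * (b ^ m).+1) else 0.

Lemma Fm_rec m u : Fm m.+1 u = \sum_(c < b) Fm_lead m u c.
Proof.
rewrite /Fm expnS sum_block; apply: eq_bigr => c _; rewrite /Fm_lead.
case: leqP => leu; last first.
  rewrite big_nat_cond big1 // => w /andP[/andP[_ ltw] _].
  by rewrite f_lead //; apply/eqP; rewrite eqb0; apply/eqP; lia.
rewrite big_nat_cond [RHS]big_nat_cond; apply: eq_bigr => w /andP[/andP[_ ltw] _].
by rewrite f_lead //; congr nat_of_bool; apply/eqP/eqP; lia.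
Qed.

Lemma Fm_lead_gt0 m u c : 0 < Fm_lead m u c ->
  c * (b ^ m).+1 <= u <= c * (b ^ m).+1 + (b ^ m + m * b.-1 - 1).
Proof.
rewrite /Fm_lead; case: (leqP _ u) => //= leu pos; rewrite leqNgt; apply: contraTN pos => lt.
by rewrite Fm_out //; lia.
Qed.

Lemma Fm_lead_gap m u c d : 0 < Fm_lead m u c -> c.+1 < d -> Fm_lead m u d = 0.
Proof.
move=> /Fm_lead_gt0 Hc ltd; apply/eqP; rewrite -leqn0 leqNgt; apply/negP => /Fm_lead_gt0 Hd.
by have := mul_pred_lt_expn m; set B := b ^ m in Hc Hd *; set M := m * _ in Hc Hd *; nia.
Qed.

(** For the digit [c] the remainder is [(b ^ m).+1 + x], which the reflection of [Fm_compl] sends to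
    [z]. *)
Lemma Fm_lead_pair m u c x z : x + z + 2 = m * b.-1 -> u = c.+1 * (b ^ m).+1 + x ->
  Fm_lead m u c.+1 = F b x /\ Fm_lead m u c = F b z.
Proof.
move=> E ->; have B := mul_pred_lt_expn m; rewrite /Fm_lead leq_addr addKn -F_Fm; last by lia.
split=> //; rewrite mulSn -addnA addnCA leq_addr addKn (F_Fm (m := m)); last by lia.
by apply: Fm_compl; lia.
Qed.

(* [x] and [z] come from the leading digits [c.+1] and [c]; no other digit
   contributes, since the values of [f] below [b ^ m] span less than two steps. *)
Lemma F_pair c m x z : c.+1 < b -> x + z + 2 = m * b.-1 ->
  c.+1 * (b ^ m).+1 + x < b ^ m.+1 ->
  F b (c.+1 * (b ^ m).+1 + x) = F b x + F b z.
Proof.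
move=> ltc E ltu; rewrite (F_Fm ltu) Fm_rec.
have [E1 E2] := Fm_lead_pair E (erefl (c.+1 * (b ^ m).+1 + x)).
set u := _ + x in E1 E2 *.
rewrite (bigD1 (Ordinal ltc)) //= E1 (bigD1 (Ordinal (ltnW ltc))) /=; last first.
  by rewrite -val_eqE /=; lia.
rewrite E2 big1 ?addn0 // => [[i lti]]; rewrite -!val_eqE /= => /andP[n1 n2].
apply/eqP; rewrite -leqn0 leqNgt; apply/negP => /Fm_lead_gt0.
have B := mul_pred_lt_expn m; have : i < c \/ c.+1 < i by lia.
rewrite /u; move: (b ^ m) (m * _) B E {E1 E2 u ltu} => B M; nia.
Qed.

(** * Decomposing numbers with several solutions *)

Lemma expn_gap k m : k <= m ->
  exists q, b ^ m = b ^ k + q * b.-1 /\ (k < m -> b ^ k <= q).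
Proof.
move=> /subnK <-; elim: (m - k) => [|e [q [IHe _]]].
  by exists 0; rewrite add0n mul0n addn0 ltnn.
have EB : b * b ^ (e + k) = b ^ (e + k) * b.-1 + b ^ (e + k).
  by rewrite -{1}(prednK b_gt0) mulSn addnC mulnC.
exists (b ^ (e + k) + q); split; first by rewrite addSn expnS EB IHe !mulnDl; lia.
by move=> _; rewrite IHe; lia.
Qed.

Lemma mul_pred_leS_expn m : 1 < m -> m.+1 * b.-1 <= (b ^ m).+1.
Proof.
elim: m => // m IHm; rewrite ltnS leq_eqVlt => /predU1P[<-|/IHm IH].
  by rewrite -{2}(prednK b_gt0) expnS expn1; nia.
have : b.-1 <= b.-1 * b ^ m by rewrite leq_pmulr // expn_gt0 b_gt0.
have EB : b * b ^ m = b.-1 * b ^ m + b ^ m by rewrite -{1}(prednK b_gt0) mulSn addnC.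
by rewrite expnS mulSn EB; lia.
Qed.

(* [y] is only required to dominate the decomposed number and to be congruent to
   it modulo [b.-1]: this is what survives the removal of leading digits. *)
Definition split_at n y m x z := [/\ x + z + 2 = m * b.-1, 0 < F b x, 0 < F b z,
  F b x + F b z = n & exists c k, 0 < c < b /\ y = c * (b ^ m).+1 + x + k * b.-1].

(** Induction on the number of digits: the least contributing digit [c] either contributes alone and
    is stripped, or does so with [c.+1], and then [Fm_lead_pair] gives [x] and [z]. *)
Lemma Fm_split m y : 1 < Fm m y -> exists2 k, k < m & exists x z, split_at (Fm m y) y k x z.
Proof.
elim: m y => [|m IHm] y.
  by rewrite /Fm expn0 big_nat1; case: (_ == _).
rewrite Fm_rec => sum_gt1.
have exc : exists c, (c < b) && (0 < Fm_lead m y c).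
  have: \sum_(c < b) Fm_lead m y c != 0 by lia.
  rewrite sum_nat_eq0 negb_forall => /existsP[c /=]; rewrite -lt0n => pos.
  by exists c; rewrite ltn_ord.
case: (ex_minnP exc) => c /andP[ltc posc] minc.
have rest i : i < b -> i != c -> i != c.+1 -> Fm_lead m y i = 0.
  move=> ltib nic nic'; have [ltic|leci] := ltnP i c.
    apply/eqP; rewrite -leqn0 leqNgt; apply/negP => posi.
    by have := minc i; rewrite ltib posi; lia.
  by apply: (Fm_lead_gap posc); lia.
have alone : \sum_(i < b) Fm_lead m y i = Fm_lead m y c ->
    exists2 k, k < m.+1 & exists x z, split_at (\sum_(i < b) Fm_lead m y i) y k x z.
  move=> sumE; rewrite sumE; move: posc sum_gt1; rewrite sumE /Fm_lead.
  case: (leqP _ y) => // lecy _ /IHm[k ltkm [x [z [Exz Fx Fz Fxz [c' [k' [/andP[c'0 ltc'] Ey]]]]]]].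
  exists k; first exact: ltnW.
  exists x, z; split=> //.
  have [q [Eq _]] := expn_gap (ltnW ltkm).
  have {lecy} Ey' : y = (c + c') * (b ^ k).+1 + x + (c * q + k') * b.-1.
    by rewrite -(subnKC lecy) Ey Eq !mulnS !mulnDl !mulnDr mulnA; lia.
  have [small|big] := ltnP (c + c') b.
    by exists (c + c'), (c * q + k'); split; [lia|].
  (* A coefficient [c + c'] that is no longer a digit gives up [b.-1] copies of [(b ^ k).+1] to the
     multiple of [b.-1]. *)
  exists (c + c' - b.-1), ((b ^ k).+1 + (c * q + k')); split; first by lia.
  rewrite Ey'; have {1}-> : c + c' = (c + c' - b.-1) + b.-1 by lia.
  by rewrite !mulnDl (mulnC b.-1); lia.
have [ltc1|lec1] := ltnP c.+1 b; last first.
  apply: alone; rewrite (bigD1 (Ordinal ltc)) //= big1 ?addn0 // => [[i lti]].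
  by rewrite -val_eqE /= => nic; apply: rest => //; lia.
have sumE : \sum_(i < b) Fm_lead m y i = Fm_lead m y c + Fm_lead m y c.+1.
  rewrite (bigD1 (Ordinal ltc)) //= (bigD1 (Ordinal ltc1)) /=; last first.
    by rewrite -val_eqE /=; lia.
  rewrite big1 ?addn0 // => [[i lti]]; rewrite -!val_eqE /= => /andP[n1 n2].
  exact: rest.
have [t0|posc1] := posnP (Fm_lead m y c.+1); first by apply: alone; rewrite sumE t0 addn0.
have Hc := Fm_lead_gt0 posc; have Hc1 := Fm_lead_gt0 posc1.
have [x Ex] : exists x, y = c.+1 * (b ^ m).+1 + x.
  by exists (y - c.+1 * (b ^ m).+1); lia.
have [z Ez] : exists z, x + z + 2 = m * b.-1.
  exists (m * b.-1 - (x + 2)); rewrite mulSn in Ex.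
  by have := expn_gt0 b m; rewrite b_gt0 /=; lia.
have [E1 E2] := Fm_lead_pair Ez Ex.
exists m => //; exists x, z; split=> //; rewrite -?E1 -?E2 //; first by rewrite sumE addnC.
by exists c.+1, 0; rewrite mul0n addn0; split; [lia|].
Qed.

Lemma F_split y : 1 < F b y -> exists m x z, split_at (F b y) y m x z.
Proof.
rewrite (F_Fm (ltn_expl y b_gt1)) => /Fm_split[m _ [x [z Hs]]].
by exists m, x, z.
Qed.

Lemma split_ge n y m x z : split_at n y m x z ->
  [/\ 0 < m, b <= b ^ m & (b ^ m).+1 + x <= y].
Proof.
case=> Exz _ _ _ [c [k [/andP[c0 _] ->]]]; have m0 : 0 < m by case: m Exz => //; lia.
split=> //; first by rewrite -{1}(expn1 b) leq_pexp2l.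
by rewrite -addnA leq_add ?leq_pmull // leq_addr.
Qed.

(** * Small values and representatives of residue classes *)

Lemma F_eq1 u v0 : v0 <= u -> (forall v, v <= u -> (f b v == u) = (v == v0)) -> F b u = 1.
Proof.
move=> le0 H; rewrite F_sum big_mkord (bigD1 (Ordinal (le0 : v0 < u.+1))) //= H // eqxx.
rewrite big1 // => [[i lti]]; rewrite -val_eqE /= => ni.
by rewrite H // (negbTE ni).
Qed.

Lemma F_eq0 u : (forall v, v <= u -> f b v != u) -> F b u = 0.
Proof.
move=> H; rewrite F_sum big_mkord big1 // => [[i lti]] _ /=.
by rewrite (negbTE (H _ _)).
Qed.

Lemma f_digit v : v < b -> f b v = v.*2.
Proof.
move=> ltv; have := @f_lead v 0 0 ltv isT.
by rewrite expn0 muln1 addn0 f0 => ->; lia.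
Qed.

Lemma F_small x : x < b -> F b x = ~~ odd x.
Proof.
move=> ltx; case ox: (odd x) => /=.
  by apply: F_eq0 => v lev; rewrite f_digit; [apply: contraTneq ox => <-; rewrite odd_double|lia].
apply: (@F_eq1 _ x./2) => [|v lev]; first by lia.
by rewrite f_digit; [apply/eqP/eqP; lia | lia].
Qed.

Lemma F_gt0_even x : odd b -> 0 < F b x -> ~~ odd x.
Proof.
move=> ob; apply: contraTN => ox; rewrite F_eq0 // => v _.
by apply: contraTneq ox => <-; apply: f_even.
Qed.

(** Here [x + z + 3 = b], so [x] and [z] are digits; having solutions, they are even with one
    solution each. *)
Lemma split_at_1 n y x z : split_at n y 1 x z -> n = 2 /\ odd b.
Proof.
case=> Exz Fx Fz <- _; rewrite mul1n in Exz.
have [ltx ltz] : x < b /\ z < b by lia.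
rewrite !F_small // in Fx Fz *; lia.
Qed.

Lemma F_pair1 m x z : x + z + 2 = m * b.-1 -> F b ((b ^ m).+1 + x) = F b x + F b z.
Proof.
move=> E; have := mul_pred_lt_expn m.
have le : 2 * b ^ m <= b ^ m.+1 by rewrite expnS leq_mul2r b_gt1 orbT.
by move=> lt; have := @F_pair 0 m x z b_gt1 E; rewrite mul1n => -> //; lia.
Qed.

Lemma F1_residue t : b.-1 <= t -> (odd b -> ~~ odd t) -> exists z k,
  [/\ t = z + k * b.-1, F b z = 1 & if odd b then z < b.-1 else z < b.-1.*2].
Proof.
move=> let_ par; have Et := divn_eq t b.-1; have ltr : t %% b.-1 < b.-1 by rewrite ltn_mod; lia.
set q := t %/ _ in Et; set r := t %% _ in Et ltr.
have [or|er] := boolP (odd r); last first.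
  exists r, q; split; [lia | by rewrite F_small ?er //; lia | case: ifP; lia].
have ob : ~~ odd b.
  apply/negP => ob; have := par ob; rewrite Et oddD oddM.
  have e : ~~ odd b.-1 by lia.
  by rewrite (negbTE e) andbF or.
have [q' Eq] : exists q', q = q'.+1.
  by exists q.-1; rewrite prednK // divn_gt0 //; lia.
(* Here [b] is even and [r] odd; adding [b.-1] gives an even number whose half is the sole
   solution. *)
exists (r + b.-1), q'; split; [by rewrite Et Eq mulSn; lia| |by rewrite (negbTE ob); lia].
apply: (@F_eq1 _ (r + b.-1)./2) => [|v lev]; first by lia.
have [ltv|lev'] := ltnP v b; first by rewrite f_digit //; apply/eqP/eqP; lia.
have -> : v = 1 * b ^ 1 + (v - b) by rewrite mul1n expn1; lia.
rewrite f_lead ?expn1 //; last by lia.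
rewrite f_digit; last by lia.
by apply/eqP/eqP; lia.
Qed.

(** The representatives are the even numbers from [b.+1] to [b.-1.*2]; each splits at [m = 1] into
    two even digits. *)
Lemma F2_residue t : odd b -> ~~ odd t -> b.-1.*2 <= t -> exists z k,
  [/\ t = z + k * b.-1, F b z = 2 & z <= b.-1.*2].
Proof.
move=> ob et let_; have Et := divn_eq t b.-1.
have ltr : t %% b.-1 < b.-1 by rewrite ltn_mod; lia.
set q := t %/ _ in Et; set r := t %% _ in Et ltr.
have er : ~~ odd r.
  have e : ~~ odd b.-1 by lia.
  by move: et; rewrite Et oddD oddM (negbTE e) andbF.
have F2 x : x.+2 < b -> ~~ odd x -> F b (b.+1 + x) = 2.
  move=> ltx ex; rewrite -{1}(expn1 b) (@F_pair1 1 x (b - x.+3)); last by lia.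
  by rewrite !F_small; lia.
have leq2 : 1 < q by rewrite /q leq_divRL; lia.
have [r0|r0] := posnP r.
  exists b.-1.*2, (q - 2); split => //; last first.
    by have := F2 (b - 3); rewrite (_ : b.+1 + (b - 3) = b.-1.*2); [apply; lia|lia].
  by rewrite Et r0 addn0 -{1}(subnK leq2) mulnDl; lia.
have Er : r + b.-1 = b.+1 + (r - 2) by lia.
exists (r + b.-1), (q - 1); split; [|by rewrite Er; apply: F2; lia|lia].
by rewrite Et -{1}(subnK (ltnW leq2)) mulnDl; lia.
Qed.

(* [F_pair] fails for [m = 1], [c = b.-1], where carries reach [b ^ 2]; the
   assumptions on [F] exclude [m = 1]. *)
Lemma F_pair_shift c m x z : 0 < c < b -> x + z + 2 = m * b.-1 ->
  1 < F b x + F b z -> (2 < F b x + F b z \/ ~~ odd b) ->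
  0 < F b x -> 0 < F b z ->
  F b (c * (b ^ m).+1 + x) = F b x + F b z.
Proof.
move=> /andP[c0 ltc] E sum_gt1 sum_gt2 Fx Fz.
have m1 : 1 < m.
  have base : m = 1 -> F b x + F b z = 2 /\ odd b.
    move=> Em; rewrite Em in E.
    by apply: (@split_at_1 _ (1 * (b ^ 1).+1 + x) x z); split=> //; exists 1, 0; lia.
  by case: m E base => [|[|m]] // E; [lia|move=> /(_ erefl)[]; lia].
have := mul_pred_leS_expn m1; rewrite mulSn => B2.
have EB : b ^ m.+1 = b.-1 * b ^ m + b ^ m by rewrite expnS -{1}(prednK b_gt0) mulSn addnC.
have lec : c * (b ^ m).+1 <= b.-1 * (b ^ m).+1 by rewrite leq_mul2r; lia.
rewrite -(prednK c0) in ltc lec *; apply: F_pair => //.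
by rewrite mulnS in lec; lia.
Qed.

(** * Lowering the count by one within a residue class *)

(** Count 2, and count 3 for odd [b], use the explicit representatives. Otherwise strong induction
    lowers [x] or [z], and [m] is shortened to match. *)
Lemma F_dec y : 1 < F b y -> exists y' k,
  [/\ y = y' + k * b.-1, F b y' = (F b y).-1, 0 < k & (2 < F b y \/ ~~ odd b) -> 1 < k].
Proof.
have [n] := ubnP y; elim: n y => // n IHn y; rewrite ltnS => leyn Fy.
have [m [x [z Hs]]] := F_split Fy; have [m0 leb ley] := split_ge Hs.
have ey : odd b -> ~~ odd y by move=> ob; apply: F_gt0_even => //; lia.
(* By [split_at_1], [m] is at least 2 here, which leaves room for two steps of [b.-1]. *)
have m1 : (2 < F b y \/ ~~ odd b) -> (b * b).+1 <= y.
  move=> H; have {}m0 : 1 < m.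
    case: m m0 Hs {leb ley} => [|[|m]] // _ /split_at_1[E ob].
    by move: H; rewrite E ob => [[]].
  have : b ^ 2 <= b ^ m by rewrite leq_pexp2l.
  by rewrite expnS expn1; lia.
have [E2|F2] := eqVneq (F b y) 2.
  have [|z1 [k [Ey F1 bnd]]] := @F1_residue y _ ey; first by lia.
  have k2 : ~~ odd b -> 1 < k.
    move=> eb; move: bnd; rewrite (negbTE eb) => bnd.
    have := m1 (or_intror eb); case: k Ey => [|[|k]] // Ey; nia.
  exists z1, k; rewrite E2 F1; split=> //; last by case.
  case: (boolP (odd b)) bnd => [_ bnd|/k2]; last by lia.
  by case: k Ey {k2} => // Ey; lia.
have m2 : (b * b).+1 <= y by apply: m1; left; lia.
have [/andP[/eqP E3 ob]|F3] := boolP ((F b y == 3) && odd b).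
  have [|z1 [k [Ey F1 bnd]]] := @F2_residue y ob (ey ob); first by nia.
  exists z1, k; rewrite E3; split=> //; first by case: k Ey => // Ey; nia.
  by move=> _; case: k Ey => [|[|k]] // Ey; nia.
(* The lowered count still meets the side condition of [F_pair_shift]. *)
have F4 : 2 < (F b y).-1 \/ ~~ odd b.
  by move: F3; rewrite negb_and; case: (odd b) => /= H; [left; lia|right].
(* Shortening [m] to [m'] alone takes off [c * q] steps of [b.-1], with [q > 1]. *)
suff [m' [x' [z' [k1 [k2 [Em Ex Exz [Fx' Fz'] Fxz]]]]]] : exists m' x' z' k1 k2,
  [/\ m = m' + k1.+1, x = x' + k2 * b.-1, x' + z' + 2 = m' * b.-1, 0 < F b x' /\ 0 < F b z'
      & F b x' + F b z' = (F b y).-1].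
  have [_ _ _ _ [c [k [cb Ey]]]] := Hs.
  have m'0 : 0 < m' by case: m' Em Exz => //; lia.
  have [q [Eq leq]] := @expn_gap m' m ltac:(lia).
  have q1 : 1 < q.
    have : b ^ 1 <= b ^ m' by rewrite leq_pexp2l.
    by have := leq ltac:(lia); lia.
  have kgt : 1 < c * q + k2 + k by case/andP: cb; nia.
  exists (c * (b ^ m').+1 + x'), (c * q + k2 + k); split=> //; last by lia.
    by rewrite Ey Eq Ex !mulnS !mulnDl !mulnDr mulnA; lia.
  by rewrite (@F_pair_shift _ _ _ z') ?Fxz //; lia.
have [Exz Fx Fz Fsum _] := Hs.
have B := mul_pred_lt_expn m.
have [Fz1|Fx1] : 1 < F b z \/ 1 < F b x by lia.
  have [|z' [k [Ez Fz' k0 _]]] := IHn z _ Fz1; first by lia.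
  have lekm : k <= m by rewrite -(leq_pmul2r (_ : 0 < b.-1)) -?Exz; lia.
  exists (m - k), x, z', k.-1, 0; split; rewrite ?Fz' ?mulnBl -?Exz; lia.
have [|x' [k [Ex Fx' k0 _]]] := IHn x _ Fx1; first by lia.
have lekm : k <= m by rewrite -(leq_pmul2r (_ : 0 < b.-1)) -?Exz; lia.
by exists (m - k), x', z, k.-1, k; split; rewrite ?Fx' ?mulnBl -?Exz; lia.
Qed.

(** * Existence, explicit counts and the descent *)

Lemma F0 : F b 0 = 1. Proof. by rewrite F_small. Qed.

(** Pairs the previous [x] with some [z] of count 1. The exponent [x + 4] is large enough for
    [F1_residue] to apply, and is then reduced by [k]. *)
Lemma F_surj n : 0 < n -> exists u, F b u = n.
Proof.
elim: n => // -[_ _|n IHn _]; first by exists 0; rewrite F0.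
have [x Fx] := IHn isT.
have ex : odd b -> ~~ odd x by move=> ob; apply: F_gt0_even; rewrite ?Fx.
have big : (x + 3) * 1 <= (x + 3) * b.-1 by rewrite leq_mul2l; lia.
have E4 : (x + 4) * b.-1 = (x + 3) * b.-1 + b.-1 by rewrite -mulSnr; congr (_ * _); lia.
have [||z [k [Et Fz _]]] := @F1_residue ((x + 4) * b.-1 - x - 2); first by lia.
  move=> ob; have e : ~~ odd b.-1 by lia.
  have e4 : ~~ odd ((x + 4) * b.-1) by rewrite oddM (negbTE e) andbF.
  by have := ex ob; lia.
have lek : k <= x + 4 by rewrite -(leq_pmul2r (_ : 0 < b.-1)) //; lia.
exists ((b ^ (x + 4 - k)).+1 + x); rewrite (@F_pair1 _ x z); first by lia.
by rewrite mulnBl; lia.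
Qed.

Lemma F_ge w : 1 < F b w -> b.+1 <= w.
Proof. by move=> /F_split[m [x [z /split_ge[]]]]; lia. Qed.

(** A split with [m >= 2] would force [w > b ^ 2], so [m = 1]. This is where the exceptional case
    arises. *)
Lemma F_ge2_small w : 1 < F b w -> w + 4 <= b.*2 -> [/\ F b w = 2, odd b & 5 <= b].
Proof.
move=> Fw lew; have [m [x [z Hs]]] := F_split Fw; have [m0 _ ley] := split_ge Hs.
case: m m0 Hs ley => [|[|m]] // _ Hs ley.
  by have [-> ob] := split_at_1 Hs; split=> //; have := F_ge Fw; lia.
have : b ^ 2 <= b ^ m.+2 by rewrite leq_pexp2l.
by rewrite expnS expn1; nia.
Qed.

Lemma F_bS : odd b -> F b b.+1 = 2.
Proof.
move=> ob; rewrite -{1}(addn0 b.+1) -{1}(expn1 b) (@F_pair1 1 0 (b - 3)); last by lia.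
by rewrite !F_small; lia.
Qed.

(** For [m = 2] the partner of 0 is [2b - 4 = b.+1 + (b - 5)], which itself comes from the digits
    [b - 5] and 2. *)
Lemma F_b2S : odd b -> 5 <= b -> F b (b ^ 2).+1 = 3.
Proof.
move=> ob b5; rewrite -(addn0 _.+1) (@F_pair1 2 0 (b.+1 + (b - 5))); last by lia.
rewrite F0 -{2}(expn1 b) (@F_pair1 1 (b - 5) 2); last by lia.
by rewrite !F_small; lia.
Qed.

Lemma F_descent n u : 0 < n -> F b u = n.+1 -> ~ (5 <= b /\ odd b /\ n = 2) ->
  exists2 u', F b u' = n & b * u' < u.
Proof.
move=> n0 Fu exc; have Fu1 : 1 < F b u by lia.
have [->|n1] := eqVneq n 1; first by exists 0; rewrite ?F0 // muln0; have := F_ge Fu1; lia.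
have {n0}n1 : 1 < n by lia.
have [m [x [z Hs]]] := F_split Fu1; have [m0 leb leu] := split_ge Hs.
have [Exz Fx Fz Fsum _] := Hs; rewrite Fu in Fsum.
have EB k : 0 < k -> b ^ k = b * b ^ k.-1 by case: k => // k _; rewrite expnS.
have one w : F b w = n -> w + 2 <= m * b.-1 -> b * w < u.
  move=> Fw lew; have Fw1 : 1 < F b w by lia.
  (* If [m <= 2], then [w + 4 <= b.*2], and [F_ge2_small] leads to the excluded case. *)
  have m2 : 2 < m.
    rewrite ltnNge; apply/negP => lem; apply: exc.
    have lem' : m * b.-1 <= 2 * b.-1 by rewrite leq_mul2r lem orbT.
    by have [|] := F_ge2_small Fw1; [lia|rewrite Fw].
  have := @mul_pred_leS_expn m.-1 ltac:(lia); rewrite prednK; last by lia.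
  move=> B2; rewrite (EB m) // in leu.
  have : b * w < b * b ^ m.-1 by rewrite ltn_mul2l b_gt0; lia.
  by lia.
have [Fx1|Fx1] := eqVneq (F b x) 1; first by exists z; [lia|apply: one; lia].
have [Fz1|Fz1] := eqVneq (F b z) 1; first by exists x; [lia|apply: one; lia].
have {Fx Fx1}Fx : 1 < F b x by lia.
have {Fz Fz1}Fz : 1 < F b z by lia.
have gex := F_ge Fx; have gez := F_ge Fz.
have m2 : 2 < m by rewrite ltnNge; apply/negP => lem; have := leq_mul lem (leqnn b.-1); lia.
have B2 := @mul_pred_leS_expn m.-1 ltac:(lia); rewrite prednK in B2; last by lia.
(* Here [b * b ^ m' <= b ^ m.-1], and the remaining [b.-1 * b ^ m.-1] of [b ^ m] absorbs
   [b.-1 * x']. *)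
have two m' x' : m' + 2 <= m -> x' <= x -> b * ((b ^ m').+1 + x') < u.
  move=> lem lex; apply: leq_trans leu.
  have le1 : b ^ m'.+1 <= b ^ m.-1 by rewrite leq_pexp2l //; lia.
  rewrite mulnDr mulnS -expnS (EB m) //.
  have : b.-1 * x' + 2 * b.-1 <= b.-1 * b ^ m.-1.
    by rewrite (mulnC 2) -mulnDr leq_mul2l; lia.
  have E1 w : b * w = w + b.-1 * w by rewrite -mulSn prednK.
  by rewrite !E1; lia.
(* Both counts are then 2, and [F_dec] guarantees only one step, too few for [two]. *)
have [sp|] := boolP ((n == 3) && odd b).
  have /andP[/eqP En ob] := sp; rewrite En.
  have [b5|b4] := leqP 5 b.
    exists (b ^ 2).+1; first exact: F_b2S.
    have : b ^ 3 <= b ^ m by rewrite leq_pexp2l.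
    by rewrite mulnS -expnS; lia.
  have Eb : b = 3 by lia.
  have F4 : F b 4 = 2 by have := F_bS ob; rewrite {2}Eb.
  (* The witness is 28. As [x] and [z] are at least 4, [m] is at least 5. *)
  exists ((b ^ 3).+1 + 0); first by rewrite (@F_pair1 3 0 4) ?F0 ?F4 //; lia.
  have : b ^ 5 <= b ^ m by rewrite leq_pexp2l //; lia.
  by rewrite Eb in leu *; lia.
rewrite negb_and => nsp.
(* The counts sum to at least 5 or [b] is even, so [F_dec] takes off at least two steps from one of
   them. *)
have [deep|deep] : (2 < F b x \/ ~~ odd b) \/ (2 < F b z \/ ~~ odd b).
  by case/orP: nsp => [|eb]; [lia|left; right].
  have [x' [k [Ex Fx' _ k1]]] := F_dec Fx; have {}k1 := k1 deep.
  have lekm : k <= m by rewrite -(leq_pmul2r (_ : 0 < b.-1)) -?Exz; lia.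
  exists ((b ^ (m - k)).+1 + x'); last by apply: two; [lia|rewrite Ex leq_addr].
  by rewrite (@F_pair1 _ x' z) ?Fx' ?mulnBl -?Exz; lia.
have [z' [k [Ez Fz' _ k1]]] := F_dec Fz; have {}k1 := k1 deep.
have lekm : k <= m by rewrite -(leq_pmul2r (_ : 0 < b.-1)) -?Exz; lia.
exists ((b ^ (m - k)).+1 + x); last by apply: two; lia.
by rewrite (@F_pair1 _ x z') ?Fz' ?mulnBl -?Exz; lia.
Qed.

(** * Minimality and the theorem *)

Lemma K_spec n u : F b u = n -> F b (K b n) = n /\ K b n <= u.
Proof.
move=> Fu; rewrite /K; case: boolp.pselect => [ex|[]]; last by exists u; apply/eqP.
by case: ex_minnP => k /eqP Fk min; split=> //; apply: min; apply/eqP.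
Qed.

End Generators.

Theorem theorem10p1 (b n : nat) (hb : 2 <= b) (hn : 1 <= n) :
  (~ (5 <= b /\ odd b /\ n = 2) -> b * K b n < K b n.+1) /\
  (5 <= b /\ odd b /\ n = 2 ->
     K b 3 <= b * K b 2 /\ (b - 1) * K b 2 < K b 3).
Proof.
split=> [exc|[b5 [ob _]]].
  have [u Fu] := F_surj hb (isT : 0 < n.+1); have [FK _] := K_spec Fu.
  have [u' Fu' lt] := F_descent hb hn FK exc; have [_ le] := K_spec Fu'.
  by apply: leq_ltn_trans lt; rewrite leq_mul2l le orbT.
(* In the exceptional case [K b 2 = b.+1] and [K b 3 = b ^ 2 + 1]; the latter because count 3
   excludes [m = 1]. *)
have [F2 le2] := K_spec (F_bS hb ob); have [F3 le3] := K_spec (F_b2S hb ob b5).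
have ge2 : b.+1 <= K b 2 by apply: F_ge; rewrite ?F2.
have ge3 : (b ^ 2).+1 <= K b 3.
  have [|m [x [z Hs]]] := @F_split b hb (K b 3); first by rewrite F3.
  rewrite F3 in Hs; have [m0 _ ley] := split_ge hb Hs.
  case: m m0 Hs ley => [|[|m]] // _ Hs ley; first by have [] := split_at_1 hb Hs.
  have : b ^ 2 <= b ^ m.+2 by rewrite leq_pexp2l //; lia.
  by lia.
rewrite expnS expn1 in le3 ge3; split.
  by apply: leq_trans le3 _; have := leq_mul (leqnn b) ge2; rewrite mulnS; lia.
have := leq_mul (leqnn (b - 1)) le2; have : (b - 1) * b.+1 < b * b by nia.
by lia.
Qed.
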